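(* Let $E_n$ be the Euler numbers, defined by $\sum_{n\ge0}E_n\frac{t^n}{n!}=\frac{2}{e^t+e^{-t}}$. Let $T(n,k)$ be the central factorial numbers of the second kind, defined by $(e^{x/2}-e^{-x/2})^k=k!\sum_{n\ge k}T(n,k)\frac{x^n}{n!}$ (so $T(0,0)=1$). Let $\Delta(x,k)$ be the polynomials defined by $\Delta(x,0)=1$ and $$\Delta(x,k+1)=(x+1)(2x+1)\Delta(x+1,k)-x^2\Delta(x,k)\quad(k\ge0).$$ Then for all non-negative integers $n$ and $k$, $$E_{2n+2k}=\sum_{j=0}^n\frac{(-1)^{j-k}(2j)!\,\Delta(j,k)}{2^j}\,T(2n,2j).$$ *)

(* Defs.v *)
From mathcomp Require Import all_boot all_order all_algebra.

Set Implicit Arguments.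
Unset Strict Implicit.
Unset Printing Implicit Defensive.

Import Order.TTheory GRing.Theory Num.Theory.
Local Open Scope ring_scope.

(* A formal power series over rat is the sequence of its coefficients. *)
Definition fps := nat -> rat.

Definition fps_const (c : rat) : fps := fun n => if n is 0%N then c else 0.
Definition fps_add (a b : fps) : fps := fun n => a n + b n.
Definition fps_sub (a b : fps) : fps := fun n => a n - b n.
Definition fps_mul (a b : fps) : fps :=
  fun n => \sum_(i < n.+1) a i * b (n - i)%N.
Definition fps_pow (a : fps) (k : nat) : fps := iter k (fps_mul a) (fps_const 1).

(* The first n coefficients of the inverse of a, obtained by solving
   a * b = 1 degree by degree; meaningful when a 0 != 0 (see fps_mulV). *)
Fixpoint fps_inv_seq (a : fps) (n : nat) : seq rat :=
  if n is m.+1 then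
    let s := fps_inv_seq a m in
    rcons s ((fps_const 1 m - \sum_(i < m) s`_i * a (m - i)%N) / a 0%N)
  else [::].
Definition fps_inv (a : fps) : fps := fun n => (fps_inv_seq a n.+1)`_n.

(* The series e^(c t). *)
Definition fps_exp (c : rat) : fps := fun n => c ^+ n / (n`!)%:R.

(* E_n = n! [t^n] 2 / (e^t + e^-t) *)
Definition euler (n : nat) : rat :=
  (n`!)%:R *
  fps_mul (fps_const 2) (fps_inv (fps_add (fps_exp 1) (fps_exp (-1)))) n.

(* T(n,k) = (n!/k!) [x^n] (e^(x/2) - e^(-x/2))^k *)
Definition cfact2 (n k : nat) : rat :=
  (n`!)%:R / (k`!)%:R *
  fps_pow (fps_sub (fps_exp (1 / 2)) (fps_exp (- (1 / 2)))) k n.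

Fixpoint Delta (k : nat) : {poly rat} :=
  if k is m.+1 then
    ('X + 1) * (2%:R *: 'X + 1) * (Delta m \Po ('X + 1)) - 'X ^+ 2 * Delta m
  else 1.

Lemma size_fps_inv_seq (a : fps) n : size (fps_inv_seq a n) = n.
Proof. by elim: n => //= n IH; rewrite size_rcons IH. Qed.

Lemma nth_fps_inv_seq (a : fps) n i :
  (i < n)%N -> (fps_inv_seq a n)`_i = fps_inv a i.
Proof.
elim: n => // n IH; rewrite ltnS leq_eqVlt => /orP[/eqP-> //|lt_in].
by rewrite /= nth_rcons size_fps_inv_seq lt_in IH.
Qed.

Lemma fps_mulV (a : fps) n :
  a 0%N != 0 -> fps_mul (fps_inv a) a n = fps_const 1 n.
Proof.
move=> a0; rewrite /fps_mul big_ord_recr /= subnn.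
rewrite {2}/fps_inv /= nth_rcons size_fps_inv_seq ltnn eqxx divfK //.
rewrite (eq_bigr (fun i : 'I_n => (fps_inv_seq a n)`_i * a (n - i)%N)).
  by rewrite addrC subrK.
by move=> i _; rewrite nth_fps_inv_seq.
Qed.

Lemma euler_egf n :
  fps_mul (fun m => euler m / (m`!)%:R)
          (fps_add (fps_exp 1) (fps_exp (-1))) n = fps_const 2 n.
Proof.
set d := fps_add _ _.
have d0 : d 0%N != 0 by [].
have mulC2 i : fps_mul (fps_const 2) (fps_inv d) i = 2 * fps_inv d i.
  by rewrite /fps_mul big_ord_recl /= subn0 big1 ?addr0 // => j _; rewrite mul0r.
transitivity (2 * fps_mul (fps_inv d) d n).
  rewrite /fps_mul mulr_sumr; apply: eq_bigr => i _.
  rewrite /euler -/d mulC2 [RHS]mulrA; congr (_ * _).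
  by rewrite mulrC mulKf // pnatr_eq0 -lt0n fact_gt0.
by rewrite fps_mulV //; case: n => [|n] /=; rewrite ?mulr1 ?mulr0.
Qed.

(* Hence the sum defining T(n,k) may be restricted to n >= k. *)
Lemma cfact2_small n k : (n < k)%N -> cfact2 n k = 0.
Proof.
move=> lt_nk; rewrite /cfact2; set a := fps_sub _ _.
suff -> : fps_pow a k n = 0 by rewrite mulr0.
have a0 : a 0%N = 0 by [].
elim: k n lt_nk => // k IH n; rewrite ltnS => le_nk.
rewrite /fps_pow iterS -/(fps_pow a k) /fps_mul big_ord_recl /= a0 mul0r add0r.
apply: big1 => i _; rewrite IH ?mulr0 //= /bump /=.
apply: leq_trans le_nk; rewrite add1n; case: n i => [|n] i; first by case: i.
by rewrite subSS ltnS leq_subr.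
Qed.

Lemma cfact2_egf n k :
  fps_pow (fps_sub (fps_exp (1 / 2)) (fps_exp (- (1 / 2)))) k n
  = (k`!)%:R * (cfact2 n k / (n`!)%:R).
Proof.
have fact_neq0 m : ((m`!)%:R : rat) != 0 by rewrite pnatr_eq0 -lt0n fact_gt0.
rewrite /cfact2; set c := fps_pow _ _ _.
by rewrite -[_ / _ * c]mulrA [_%:R * (_ * c)]mulrC mulfK // mulVKf.
Qed.

(* Main.v *)
(** Write [s = e^(x/2) - e^(-x/2)]. Since [s^2 = e^x + e^(-x) - 2], the
    generating function of the Euler numbers is the geometric series
    [2 / (2 + s^2) = \sum_j (-1/2)^j s^(2j)], which is the case [k = 0].
    From [s'^2 = s^2/4 + 1] and [s'' = s/4] one gets
    [(s^(2j))'' = 2j (2j-1) s^(2j-2) + j^2 s^(2j)], so differentiating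
    [\sum_j a_j s^(2j)] twice replaces [a_j] by
    [j^2 a_j + (2j+2) (2j+1) a_(j+1)]; for [a_j = (-1)^(j-k) Delta(j,k) / 2^j]
    this is exactly the recurrence defining [Delta].  Power series are handled
    through their polynomial truncations modulo ['X^M]. *)

Require Import Defs.
From mathcomp Require Import all_boot all_order all_algebra.
From mathcomp Require Import ring zify.
Set Implicit Arguments.
Unset Strict Implicit.
Unset Printing Implicit Defensive.
Import GRing.Theory.
Local Open Scope ring_scope.

(** * Congruence of polynomials modulo ['X^M] *)

Definition eqmodX (M : nat) (p q : {poly rat}) : Prop :=
  take_poly M p = take_poly M q.

Lemma coef_eqmodX M p q i : eqmodX M p q -> (i < M)%N -> p`_i = q`_i.
Proof. by move=> /polyP/(_ i); rewrite !coef_take_poly => + iM; rewrite iM. Qed.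

Lemma eqmodXI M (p q : {poly rat}) :
  (forall i, (i < M)%N -> p`_i = q`_i) -> eqmodX M p q.
Proof. by move=> h; apply/polyP => i; rewrite !coef_take_poly; case: ifP => // /h. Qed.

Lemma eqmodX_refl M p : eqmodX M p p.
Proof. by []. Qed.

Lemma eqmodX_sym M p q : eqmodX M p q -> eqmodX M q p.
Proof. exact: esym. Qed.

Lemma eqmodX_trans M q p r : eqmodX M p q -> eqmodX M q r -> eqmodX M p r.
Proof. exact: etrans. Qed.

Lemma eqmodXW M M' p q : (M' <= M)%N -> eqmodX M p q -> eqmodX M' p q.
Proof.
move=> le_MM h; apply: eqmodXI => i iM.
by apply: coef_eqmodX h _; apply: leq_trans le_MM.
Qed.

Lemma eqmodXD M p q p' q' :
  eqmodX M p q -> eqmodX M p' q' -> eqmodX M (p + p') (q + q').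
Proof. by rewrite /eqmodX !take_polyD => -> ->. Qed.

Lemma eqmodXM M p q p' q' :
  eqmodX M p q -> eqmodX M p' q' -> eqmodX M (p * p') (q * q').
Proof.
move=> h1 h2; apply: eqmodXI => i iM; rewrite !coefM.
apply: eq_bigr => j _; have := ltn_ord j => ji.
by congr (_ * _); [apply: coef_eqmodX h1 _ | apply: coef_eqmodX h2 _]; lia.
Qed.

Lemma eqmodX_deriv M p q : eqmodX M.+1 p q -> eqmodX M p^`() q^`().
Proof.
move=> h; apply: eqmodXI => i iM.
by rewrite !coef_deriv (coef_eqmodX h).
Qed.

(** * Truncated power series and exponentials *)

Definition trunc (M : nat) (a : fps) : {poly rat} := \poly_(i < M) a i.

Lemma coef_trunc M a i : (i < M)%N -> (trunc M a)`_i = a i.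
Proof. by move=> iM; rewrite coef_poly iM. Qed.

Lemma coef_truncM M a b i :
  (i < M)%N -> (trunc M a * trunc M b)`_i = fps_mul a b i.
Proof.
move=> iM; rewrite coefM; apply: eq_bigr => j _.
have := ltn_ord j => ji; by rewrite !coef_trunc //; lia.
Qed.

Lemma coef_truncX M a k i :
  (i < M)%N -> (trunc M a ^+ k)`_i = fps_pow a k i.
Proof.
elim: k i => [|k IH] i iM; first by rewrite expr0 coef1; case: i iM.
rewrite exprS coefM /fps_pow iterS; apply: eq_bigr => j _.
have := ltn_ord j => ji; by rewrite coef_trunc ?IH //; lia.
Qed.

Lemma natf_fact_neq0 n : ((n`!)%:R : rat) != 0.
Proof. by rewrite Num.Theory.pnatr_eq0 -lt0n fact_gt0. Qed.

(** The binomial theorem divided by [n!]. *)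
Lemma fps_expD a b n : fps_mul (fps_exp a) (fps_exp b) n = fps_exp (a + b) n.
Proof.
rewrite /fps_mul /fps_exp addrC exprDn mulr_suml; apply: eq_bigr => i _.
have le_in : (i <= n)%N by rewrite -ltnS.
rewrite -mulr_natr -(bin_fact le_in) !natrM.
have := natf_fact_neq0 i; have := natf_fact_neq0 (n - i).
have : ('C(n, i)%:R : rat) != 0.
  by rewrite Num.Theory.pnatr_eq0 -lt0n bin_gt0.
by move=> h1 h2 h3; field; rewrite h1 h2 h3.
Qed.

Definition expT (M : nat) (c : rat) : {poly rat} := trunc M (fps_exp c).

Lemma expTD M a b : eqmodX M (expT M a * expT M b) (expT M (a + b)).
Proof. by apply: eqmodXI => i iM; rewrite coef_truncM ?fps_expD ?coef_trunc. Qed.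

Lemma expT0 M : eqmodX M (expT M 0) 1.
Proof.
apply: eqmodXI => i iM; rewrite coef_trunc // /fps_exp coef1 expr0n.
by case: i iM => [|i] _; rewrite ?divr1 ?mul0r.
Qed.

Lemma deriv_expT M c : eqmodX M (expT M.+1 c)^`() (c *: expT M.+1 c).
Proof.
apply: eqmodXI => i iM; rewrite coef_deriv coefZ !coef_trunc ?ltnS //; last exact: ltnW.
rewrite -mulr_natr /fps_exp factS natrM exprS.
have := natf_fact_neq0 i.
have : (i.+1%:R : rat) != 0 by rewrite Num.Theory.pnatr_eq0.
move: (i.+1%:R) (i`!)%:R => a b h1 h2.
by field; rewrite h1 h2.
Qed.

(* Half-argument normalisation: [sinhT] truncates [2 sinh(x/2)] and [coshT] its
   derivative [cosh(x/2)]. *)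
Definition sinhT (M : nat) : {poly rat} := expT M (1 / 2) - expT M (- (1 / 2)).
Definition coshT (M : nat) : {poly rat} :=
  (1 / 2)%:P * (expT M (1 / 2) + expT M (- (1 / 2))).

Lemma coef_sinhTX M k n :
  (n < M)%N -> (sinhT M ^+ k)`_n = (k`!)%:R * (cfact2 n k / (n`!)%:R).
Proof.
move=> nM; rewrite -cfact2_egf -(@coef_truncX M) //; congr (nth 0 (polyseq (_ ^+ k)) n).
by apply/polyP => i; rewrite coefB !coef_poly; case: ifP => //; rewrite subr0.
Qed.

Lemma deriv_sinhT M : eqmodX M (sinhT M.+1)^`() (coshT M.+1).
Proof.
apply: eqmodXI => i iM; rewrite /sinhT /coshT derivB coefB !(coef_eqmodX (deriv_expT _ _) iM).
by rewrite !coefZ coefCM coefD; field.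
Qed.

Lemma deriv_coshT M : eqmodX M (coshT M.+1)^`() ((1 / 4)%:P * sinhT M.+1).
Proof.
apply: eqmodXI => i iM; rewrite /sinhT /coshT derivM derivC mul0r add0r derivD.
rewrite !coefCM coefD !(coef_eqmodX (deriv_expT _ _) iM) !coefZ coefB.
by field.
Qed.

Lemma expT_mulV M : eqmodX M (expT M (1 / 2) * expT M (- (1 / 2))) 1.
Proof.
apply: eqmodX_trans _ (expT0 M).
by rewrite -[in expT M 0](subrr (1 / 2)); exact: expTD.
Qed.

Lemma sinhT_sqr M :
  eqmodX M (sinhT M ^+ 2) (expT M 1 + expT M (-1) - 2%:R).
Proof.
have -> : sinhT M ^+ 2 = expT M (1 / 2) * expT M (1 / 2)
    + expT M (- (1 / 2)) * expT M (- (1 / 2))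
    + (- 2%:R) * (expT M (1 / 2) * expT M (- (1 / 2))).
  by rewrite /sinhT; ring.
apply: eqmodXD; last first.
  rewrite -[X in eqmodX _ _ X]mulr1.
  exact: eqmodXM (@eqmodX_refl M _) (expT_mulV M).
apply: eqmodXD.
  have {3}-> : (1 : rat) = 1 / 2 + 1 / 2 by field.
  exact: expTD.
have -> : (-1 : rat) = - (1 / 2) + - (1 / 2) by field.
exact: expTD.
Qed.

Lemma coshT_sqr M :
  eqmodX M (coshT M ^+ 2) ((1 / 4)%:P * sinhT M ^+ 2 + 1).
Proof.
have h1 : (1 / 2 : rat)%:P * 2%:R = 1 :> {poly rat}.
  by rewrite -polyC_natr -polyCM.
have h2 : (1 / 4 : rat)%:P = (1 / 2)%:P ^+ 2 :> {poly rat}.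
  by rewrite -rmorphXn.
have -> : coshT M ^+ 2 = (1 / 4)%:P * sinhT M ^+ 2
   + expT M (1 / 2) * expT M (- (1 / 2)).
  (* The identity [(u + v)^2 / 4 = (u - v)^2 / 4 + u * v] needs [4 * (1 / 4) = 1]. Since [ring]
     treats the constant polynomial [(1 / 2)%:P] as an atom, this factor is inserted by hand. *)
  have hab u : u = ((1 / 2)%:P * 2%:R) ^+ 2 * u :> {poly rat}.
    by rewrite h1 expr1n mul1r.
  by rewrite h2 /coshT /sinhT [X in _ = _ + X]hab; ring.
exact: eqmodXD (@eqmodX_refl M _) (expT_mulV M).
Qed.

(** With [c = s'], [c' = s / 4] and [c^2 = s^2 / 4 + 1], the second derivative is
    [(m+2) ((m+1) s^m c^2 + s^(m+1) c')]. Each derivative costs one order of precision, hence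
    truncation at [M.+2] for a congruence at order [M]. *)
Lemma deriv2_sinhTX M m :
  eqmodX M (sinhT M.+2 ^+ m.+2)^`()^`()
    ((m.+2 * m.+1)%:R * sinhT M.+2 ^+ m
     + (m.+2%:R ^+ 2 / 4%:R)%:P * sinhT M.+2 ^+ m.+2).
Proof.
set P := sinhT M.+2; set C := coshT M.+2.
have dX p j : (p ^+ j.+1)^`() = j.+1%:R * p ^+ j * p^`() :> {poly rat}.
  by rewrite deriv_exp -mulr_natl; ring.
have h1 : eqmodX M.+1 (P ^+ m.+2)^`() (m.+2%:R * P ^+ m.+1 * C).
  by rewrite dX; exact: eqmodXM (@eqmodX_refl _ _) (deriv_sinhT _).
apply: eqmodX_trans (eqmodX_deriv h1) _.
rewrite -mulrA derivM -polyC_natr derivC mul0r add0r derivM dX.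
have d1 : eqmodX M P^`() C by apply: eqmodXW _ (deriv_sinhT _).
have d2 : eqmodX M C^`() ((1 / 4)%:P * P) by apply: eqmodXW _ (deriv_coshT _).
have d3 : eqmodX M (C ^+ 2) ((1 / 4)%:P * P ^+ 2 + 1).
  by apply: eqmodXW _ (coshT_sqr _); lia.
have := eqmodXM (@eqmodX_refl M (m.+2%:R%:P)) (eqmodXD
  (eqmodXM (eqmodXM (@eqmodX_refl M (m.+1%:R * P ^+ m)) d1) (@eqmodX_refl M C))
  (eqmodXM (@eqmodX_refl M (P ^+ m.+1)) d2)).
move/eqmodX_trans; apply.
have := eqmodXM (@eqmodX_refl M (m.+2%:R%:P)) (eqmodXD
  (eqmodXM (@eqmodX_refl M (m.+1%:R * P ^+ m)) d3)
  (@eqmodX_refl M (P ^+ m.+1 * ((1 / 4)%:P * P)))).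
rewrite -[m.+1%:R * _ * C * C]mulrA -expr2 => /eqmodX_trans; apply.
suff -> : (m.+2%:R ^+ 2 / 4%:R)%:P = m.+2%:R ^+ 2 * (1 / 4)%:P :> {poly rat}.
  rewrite polyC_natr natrM -natr1.
  by rewrite /eqmodX; congr (take_poly M _); rewrite !exprS; ring.
by rewrite mul1r polyCM polyC_exp polyC_natr.
Qed.

(** Compare the coefficients of degree [n] in [deriv2_sinhTX]. *)
Lemma cfact2_rec n m :
  cfact2 n.+2 m.+2 = cfact2 n m + m.+2%:R ^+ 2 / 4%:R * cfact2 n m.+2.
Proof.
have := coef_eqmodX (deriv2_sinhTX n.+1 m) (ltnSn n).
rewrite !coef_deriv -mulrnA -[X in X = _ -> _]mulr_natr coefD coefCM.
rewrite -polyC_natr coefCM !coef_sinhTX //; try by lia.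
rewrite !factS !natrM.
have := natf_fact_neq0 n; have := natf_fact_neq0 m.
have h1 : (n.+1%:R : rat) != 0 by rewrite Num.Theory.pnatr_eq0.
have h2 : (n.+2%:R : rat) != 0 by rewrite Num.Theory.pnatr_eq0.
have h3 : (m.+1%:R : rat) != 0 by rewrite Num.Theory.pnatr_eq0.
have h4 : (m.+2%:R : rat) != 0 by rewrite Num.Theory.pnatr_eq0.
move: h1 h2 h3 h4.
move: (n.+1%:R) (n.+2%:R) (m.+1%:R) (m.+2%:R) (n`!)%:R (m`!)%:R
  (cfact2 n.+2 m.+2) (cfact2 n m) (cfact2 n m.+2)
  => a b c d fn fm x y z ha hb hc hd hm hn e.
(* The common factor [(m+2)! / n!] of all three terms, to be cancelled. *)
have h : d * c * fm / fn != 0.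
  by rewrite !mulf_neq0 ?invr_eq0.
apply: (mulfI h).
transitivity (d * (c * fm) * (x / (b * (a * fn))) * (b * a)).
  by field; rewrite ha hb hn.
by rewrite e; field.
Qed.

Lemma cfact2S0 n : cfact2 n.+1 0 = 0.
Proof. by rewrite /cfact2 /= mulr0. Qed.

(** * The Euler numbers as a finite geometric sum *)

Lemma euler_cfact2 N m : (m < 2 * N)%N ->
  euler m = \sum_(0 <= j < N)
    (-1 / 2) ^+ j * ((2 * j)`!)%:R * cfact2 m (2 * j).
Proof.
move=> mN; set M := (2 * N)%N.
pose E := trunc M (fun i => euler i / (i`!)%:R).
pose D := expT M 1 + expT M (-1); pose P := sinhT M.
pose y := (-1 / 2)%:P * P ^+ 2; pose G := \sum_(j < N) y ^+ j.
have hE : eqmodX M (E * D) 2%:R%:P.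
  have -> : D = trunc M (fps_add (fps_exp 1) (fps_exp (-1))).
    apply/polyP => i; rewrite coefD !coef_poly.
    by case: ifP => // _; rewrite addr0.
  by apply: eqmodXI => i iM; rewrite coef_truncM // euler_egf coefC; case: i iM.
(* [y ^+ N] is a multiple of [s^(2N)], which has no term of degree below [2N = M]; so the geometric
   sum may stop at [N]. *)
have hPM : eqmodX M (y ^+ N) 0.
  apply: eqmodXI => i iM; rewrite exprMn -rmorphXn coefCM -exprM coef_sinhTX //.
  by rewrite cfact2_small // mul0r !mulr0 coef0.
have hD : eqmodX M D (2%:R%:P * (1 - y)).
  have -> : 2%:R%:P * (1 - y) = P ^+ 2 + 2%:R.
    have h : 2%:R%:P * (-1 / 2 : rat)%:P = -1 :> {poly rat}.
      by rewrite -polyCM -polyCN.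
    by rewrite /y mulrBr mulrA h polyC_natr; ring.
  have -> : D = D - 2%:R + 2%:R by rewrite subrK.
  by apply: eqmodXD => //; apply/eqmodX_sym/sinhT_sqr.
have hG : eqmodX M (G * D) 2%:R%:P.
  apply: eqmodX_trans (eqmodXM (@eqmodX_refl M G) hD) _.
  have -> : G * (2%:R%:P * (1 - y)) = 2%:R%:P + (- 2%:R%:P) * y ^+ N.
    have := subrX1 y N; rewrite -/G => e.
    have -> : y ^+ N = 1 + (y - 1) * G by rewrite -e; ring.
    by ring.
  rewrite -[X in eqmodX _ _ X]addr0 -[X in eqmodX _ _ (_ + X)](mulr0 (- 2%:R%:P)).
  by apply: eqmodXD => //; apply: eqmodXM.
have hEG : E`_m = G`_m.
  (* [D] is never inverted: [2 E = E (G D) = G (E D) = 2 G] modulo ['X^M]. *)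
  have h : eqmodX M (E * 2%:R%:P) (G * 2%:R%:P).
    apply: eqmodX_trans (eqmodXM (@eqmodX_refl M E) (eqmodX_sym hG)) _.
    by rewrite mulrCA; exact: eqmodXM (@eqmodX_refl M G) hE.
  by have := coef_eqmodX h mN; rewrite !coefMC => /mulIf; apply.
move: hEG; rewrite coef_trunc // coef_sum => e.
rewrite -[LHS](divfK (natf_fact_neq0 m)) e mulr_suml big_mkord.
apply: eq_bigr => j _.
rewrite exprMn -rmorphXn coefCM -exprM coef_sinhTX //.
by field; rewrite natf_fact_neq0.
Qed.

(** * Induction on [k] *)

Lemma exprzN1_sub (j k : nat) :
  (-1) ^ (j%:Z - k%:Z) = (-1) ^+ j * (-1) ^+ k :> rat.
Proof.
rewrite expfzDr ?oppr_eq0 ?oner_eq0 // -exprnP; congr (_ * _).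
by rewrite -invr_expz -exprnP -exprVn invrN1.
Qed.

Lemma Delta_rec k (x : rat) :
  (Delta k.+1).[x] =
  (x + 1) * (2 * x + 1) * (Delta k).[x + 1] - x ^+ 2 * (Delta k).[x].
Proof. by rewrite /= !hornerE horner_comp !hornerE. Qed.

Theorem theorem5 (n k : nat) :
  euler (2 * n + 2 * k) =
  \sum_(0 <= j < n.+1)
     ((-1) ^ (j%:Z - k%:Z) * ((2 * j)`!)%:R * (Delta k).[j%:R] / 2 ^+ j)
     * cfact2 (2 * n) (2 * j).
Proof.
elim: k n => [|k IH] n.
  rewrite muln0 addn0 (@euler_cfact2 n.+1); last by lia.
  apply: eq_bigr => j _; rewrite exprzN1_sub /= hornerC expr_div_n.
  by ring.
(* The case [(n, k+1)] comes from the induction hypothesis at [(n+1, k)]. Its term [j = 0] vanishes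
   because [T(2n+2, 0) = 0], so the index shifts by one. *)
have -> : (2 * n + 2 * k.+1 = 2 * n.+1 + 2 * k)%N by lia.
rewrite IH big_nat_recl //=.
have -> : (2 * n.+1 = (2 * n).+2)%N by lia.
rewrite muln0 cfact2S0 mulr0 add0r.
(* [a j] is the coefficient of [s^(2j)] in the [2k]-th derivative of the Euler series, and [U j] is
   [(2n)!] times the coefficient of [x^(2n)] in [s^(2j)]. *)
pose a j : rat := (-1) ^ (j%:Z - k%:Z) * (Delta k).[j%:R] / 2 ^+ j.
pose U j : rat := ((2 * j)`!)%:R * cfact2 (2 * n) (2 * j).
transitivity (\sum_(0 <= j < n.+1)
  ((2 * j).+2%:R * (2 * j).+1%:R * a j.+1 * U j
   + j.+1%:R ^+ 2 * a j.+1 * U j.+1)).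
  apply: eq_bigr => j _; rewrite /U /a.
  have -> : (2 * j.+1 = (2 * j).+2)%N by lia.
  rewrite cfact2_rec !factS !natrM.
  have -> : ((2 * j).+2%:R : rat) = 2 * j.+1%:R by rewrite -natrM; congr _%:R; lia.
  by field; rewrite expf_neq0.
rewrite big_split /=.
(* Shifting the index back loses the top term, zero since [T(2n, 2n+2) = 0], and gains the term
   [j = 0], zero by its factor [j^2]. *)
have -> : \sum_(0 <= j < n.+1) j.+1%:R ^+ 2 * a j.+1 * U j.+1
          = \sum_(0 <= j < n.+1) j%:R ^+ 2 * a j * U j.
  rewrite big_nat_recr //= [RHS]big_nat_recl //=.
  rewrite {2}/U cfact2_small; last by lia.
  by rewrite !mulr0 addr0 expr0n /= !mul0r add0r.
(* Termwise this is [Delta_rec] at [x = j]: the extra 2 in [2^(j+1)] turns [2j+2] into [j+1], and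
   passing from [k] to [k+1] flips the sign of the [j^2] term. *)
rewrite -big_split /=; apply: eq_bigr => j _.
rewrite Delta_rec /a /U !exprzN1_sub -[j.+1%:R]natr1 !exprS.
have -> : ((2 * j).+2%:R : rat) = 2 * (j%:R + 1).
  by rewrite natr1 -natrM; congr _%:R; lia.
have -> : ((2 * j).+1%:R : rat) = 2 * j%:R + 1.
  by rewrite -natrM natr1.
by field; rewrite expf_neq0.
Qed.
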